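(* Let $(\mathcal{Z},\langle\cdot,\cdot\rangle)$ be a real Hilbert (parameter) space. Suppose the following hold: 1. $G$ is a group acting linearly on $\mathcal{Z}$ with an adjoint, i.e. $\langle g\cdot z,z'\rangle=\langle z,g^{-1}\cdot z'\rangle$ for all $g\in G$, $z,z'\in\mathcal{Z}$; 2. the loss function $L:\mathcal{Z}\to\mathbb{R}$ is stable under $G$, that is, $L(g\cdot z)=L(z)$ for any $g\in G$ and $z\in\mathcal{Z}$; 3. the initialization distribution $z^{(0)}\sim(\mathcal{Z},p)$ is stable under $G$, that is, the laws of $z^{(0)}$ and $g\cdot z^{(0)}$ coincide for any $g\in G$. Let $\Omega_0:\mathcal{Z}\to\mathcal{Z}$ be an optimization iteration that is $G$-equivariant, i.e. $\Omega_0(g\cdot z)=g\cdot\Omega_0(z)$ for all $z\in\mathcal{Z}$, $g\in G$. If $\Omega_0$ is evolved using a gradient step (with step-size $\eta$) to minimize $$\mathcal{L}(\Omega)=\mathbb{E}_{z_0\sim p}[L(z_1)],\qquad z_1=\Omega(z_0),$$ then the evolved optimizer $\Omega_1=\Omega_0-\eta\,\frac{d\mathcal{L}}{d\Omega}(\Omega_0)$ is also $G$-equivariant.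
   Context: ''Acting linearly'' means $g\cdot(z+z')=g\cdot z+g\cdot z'$ and $g\cdot(\lambda z)=\lambda\,g\cdot z$ for all $g\in G$, $z,z'\in\mathcal{Z}$, $\lambda\in\mathbb{R}$. The optimization iterations $\Omega$ are regarded as elements of the Hilbert space $L^2(\mathcal{Z},\mathcal{Z},p)$ with inner product $\langle\Omega,\Xi\rangle=\mathbb{E}_{z\sim p}[\langle\Omega(z),\Xi(z)\rangle_{\mathcal{Z}}]$. In particular $\Omega_0\in L^2(\mathcal{Z},\mathcal{Z},p)$; $\mathcal{L}$ is assumed well defined and differentiable at $\Omega_0$, and $\frac{d\mathcal{L}}{d\Omega}(\Omega_0)$ is the gradient of $\mathcal{L}$ at $\Omega_0$ in this Hilbert space. $G$ acts on $L^2(\mathcal{Z},\mathcal{Z},p)$ by conjugation, $(g\cdot\Omega)(z)=g\cdot[\Omega(g^{-1}\cdot z)]$; $\Omega$ is $G$-equivariant if and only if $g\cdot\Omega=\Omega$ for all $g\in G$ (for elements of $L^2(\mathcal{Z},\mathcal{Z},p)$, equality is as elements of this space, i.e. $p$-almost everywhere). *)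

(* Defs.v *)
From HB Require Import structures.
From mathcomp Require Import all_boot all_order all_algebra.
From mathcomp Require Import all_classical all_reals all_analysis.
From mathcomp Require Import measurable_realfun.
From mathcomp Require Import ring lra.

Set Implicit Arguments.
Unset Strict Implicit.
Unset Printing Implicit Defensive.

Import Order.TTheory GRing.Theory Num.Theory numFieldNormedType.Exports.

Local Open Scope classical_set_scope.
Local Open Scope ring_scope.

Section dot_theory.
Context (R : realType) (V : lmodType R) (f : {dot V for @idfun R}).

Lemma dotC x y : f x y = f y x.
Proof. by rewrite hermitian_subproof expr0 mul1r. Qed.

Lemma dotDl x y z : f (x + y) z = f x z + f y z.
Proof. exact: linearDl. Qed.

Lemma dotDr x y z : f z (x + y) = f z x + f z y.
Proof. by rewrite !(dotC z) dotDl. Qed.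

Lemma dotZl a x z : f (a *: x) z = a * f x z.
Proof. exact: linearZl_LR. Qed.

Lemma dotZr a x z : f z (a *: x) = a * f z x.
Proof. by rewrite !(dotC z) dotZl. Qed.

Lemma dot0l z : f 0 z = 0.
Proof. by rewrite -(scale0r (0 : V)) dotZl mul0r. Qed.

Lemma dot_ge0 x : 0 <= f x x.
Proof.
have [->|/(neq0_dnorm_gt0 (s := f))/ltW//] := eqVneq x 0.
by rewrite dot0l.
Qed.

Lemma dot_eq0 x : (f x x == 0) = (x == 0).
Proof.
have [->|/(neq0_dnorm_gt0 (s := f)) h] := eqVneq x 0.
  by rewrite dot0l eqxx.
by rewrite gt_eqF.
Qed.

Lemma dot_CauchySchwarz x y : f x y ^+ 2 <= f x x * f y y.
Proof.
have [->|y0] := eqVneq y 0.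
  by rewrite dotC !dot0l mulr0 expr0n.
have yy0 : 0 < f y y := neq0_dnorm_gt0 y y0.
rewrite -subr_ge0 -(pmulr_rge0 _ yy0).
have := dot_ge0 (f y y *: x + (- f x y) *: y).
rewrite !(dotDl, dotDr, dotZl, dotZr) (dotC y x); congr (_ <= _); ring.
Qed.

Definition dot_norm x := Num.sqrt (f x x).

Lemma dot_normD x y : dot_norm (x + y) <= dot_norm x + dot_norm y.
Proof.
rewrite -[leRHS]ger0_norm ?addr_ge0 ?sqrtr_ge0// -sqrtr_sqr ler_wsqrtr//.
have h : f x y <= Num.sqrt (f x x) * Num.sqrt (f y y).
  rewrite -sqrtrM ?dot_ge0// (le_trans (ler_norm _))//.
  by rewrite -sqrtr_sqr ler_wsqrtr// dot_CauchySchwarz.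
rewrite /dot_norm sqrrD !sqr_sqrtr ?dot_ge0// !(dotDl, dotDr) (dotC y x) mulr2n.
lra.
Qed.

Lemma dot_normZ a x : dot_norm (a *: x) = `|a| * dot_norm x.
Proof.
by rewrite /dot_norm dotZl dotZr mulrA -expr2 sqrtrM ?sqr_ge0// sqrtr_sqr.
Qed.

Lemma dot_norm_eq0 x : dot_norm x = 0 -> x = 0.
Proof.
move/eqP; rewrite sqrtr_eq0 => h; apply/eqP; rewrite -dot_eq0.
by rewrite eq_le h dot_ge0.
Qed.

End dot_theory.

(* A real inner product inducing the norm. Completeness is added in [Hilbert]. *)
HB.mixin Record NormedModule_hasInner (R : realType) H & NormedModule R H := {
  inner : H -> H -> R ;
  innerC : forall x y, inner x y = inner y x ;
  innerDl : forall x y z, inner (x + y) z = inner x z + inner y z ;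
  innerZl : forall a x y, inner (a *: x) y = a * inner x y ;
  inner_sqr_norm : forall x, inner x x = `|x| ^+ 2 }.

#[short(type="preHilbertType")]
HB.structure Definition PreHilbert (R : realType) :=
  {H of NormedModule_hasInner R H & NormedModule R H}.

#[short(type="hilbertType")]
HB.structure Definition Hilbert (R : realType) :=
  {H of PreHilbert R H & CompleteNormedModule R H}.

Section inner_theory.
Context (R : realType) (H : preHilbertType R).

Lemma innerDr (x y z : H) : inner z (x + y) = inner z x + inner z y.
Proof. by rewrite !(innerC z) innerDl. Qed.

Lemma innerZr a (x z : H) : inner z (a *: x) = a * inner z x.
Proof. by rewrite !(innerC z) innerZl. Qed.

Let inner_bilinear : bilinear_for *%R (idfun \; *%R) (@inner R H).
Proof. by split=> x a y z; rewrite ?(innerDl, innerZl) ?(innerDr, innerZr). Qed.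

HB.instance Definition _ :=
  @bilinear_isBilinear.Build R H H R *%R (idfun \; *%R) (@inner R H) inner_bilinear.

Let inner_hermitian (x y : H) : inner x y = (-1) ^+ false * idfun (inner y x).
Proof. by rewrite expr0 mul1r innerC. Qed.

HB.instance Definition _ :=
  @isHermitianSesquilinear.Build R H false idfun (@inner R H) inner_hermitian.

Let inner_gt0 (x : H) : x != 0 -> 0 < inner x x.
Proof. by move=> x0; rewrite inner_sqr_norm exprn_gt0// normr_gt0. Qed.

HB.instance Definition _ := @isDotProduct.Build R H (@inner R H) inner_gt0.

Lemma inner_polar (x y : H) :
  inner x y = (`|x + y| ^+ 2 - `|x| ^+ 2 - `|y| ^+ 2) / 2.
Proof.
by rewrite -!inner_sqr_norm !(innerDl, innerDr) (innerC y x); field.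
Qed.

Lemma cvg_inner (x y : H^nat) (a b : H) :
  x @ \oo --> a -> y @ \oo --> b ->
  (fun n => inner (x n) (y n)) @ \oo --> inner a b.
Proof.
move=> xa yb; under eq_fun do rewrite inner_polar; rewrite inner_polar.
have sq (u : H^nat) c : u @ \oo --> c -> (fun n => `|u n| ^+ 2) @ \oo --> `|c| ^+ 2.
  by move=> uc; rewrite expr2; under eq_fun do rewrite expr2;
    apply: cvgM; exact: cvg_norm.
apply: cvgMl; apply: cvgB; first apply: cvgB; apply: sq => //.
exact: cvgD.
Qed.

Lemma inner_le_norm (x y : H) : `|inner x y| <= `|x| ^+ 2 + `|y| ^+ 2.
Proof.
have h : `|inner x y| <= `|x| * `|y|.
  have -> : `|x| * `|y| = `| `|x| * `|y| | by rewrite ger0_norm// mulr_ge0.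
  rewrite -!sqrtr_sqr ler_wsqrtr// exprMn -!inner_sqr_norm.
  exact: (dot_CauchySchwarz (@inner R H)).
apply: le_trans h _; have := sqr_ge0 (`|x| - `|y|).
have := sqr_ge0 `|x|; have := sqr_ge0 `|y|; rewrite !expr2; lra.
Qed.

Lemma sqr_normD (x y : H) : `|x + y| ^+ 2 <= 2 * (`|x| ^+ 2 + `|y| ^+ 2).
Proof.
rewrite -!inner_sqr_norm; have := sqr_ge0 `|x - y|.
rewrite -inner_sqr_norm -scaleN1r.
by rewrite !(innerDl, innerDr, innerZl, innerZr) (innerC y x); lra.
Qed.

End inner_theory.

Section strongly_measurable.
Context d (T : measurableType d).

(* Bochner measurability: pointwise limit of finitely-valued measurable maps.
   For a separable target it is the same as Borel measurability; in general it
   is the notion that makes square-integrable maps a vector space. *)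
Definition simple_map (K : Type) (s : T -> K) :=
  finite_set (range s) /\ forall y, measurable (s @^-1` [set y]).

Definition strongly_measurable (K : topologicalType) (f : T -> K) :=
  exists2 s : nat -> T -> K, (forall n, simple_map (s n)) &
    forall x, (fun n => s n x) @ \oo --> f x.

Lemma simple_map_preimage (K : Type) (s : T -> K) (A : set K) :
  simple_map s -> measurable (s @^-1` A).
Proof.
move=> [fs ms].
rewrite (_ : s @^-1` A = \bigcup_(y in range s `&` A) s @^-1` [set y]).
  apply: fin_bigcup_measurable => //; exact: finite_setIl.
apply/seteqP; split => x /=; first by move=> Asx; exists (s x).
by move=> [y [_ Ay] /= ->].
Qed.

Lemma simple_map_comp2 (K1 K2 K : Type) (phi : K1 -> K2 -> K) s t :
  simple_map s -> simple_map t -> simple_map (fun x => phi (s x) (t x)).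
Proof.
move=> ss st; split.
  apply: (@sub_finite_set _ _ ((fun u => phi u.1 u.2) @` (range s `*` range t))).
    by move=> _ [x _ <-]; exists (s x, t x).
  by apply/finite_image/finite_setX; [case: ss|case: st].
move=> y; rewrite (_ : _ @^-1` _ = \bigcup_(u in range s `&` setT)
    (s @^-1` [set u] `&` t @^-1` [set v | phi u v = y])).
  apply: fin_bigcup_measurable; first by apply: finite_setIl; case: ss.
  by move=> u _; apply: measurableI; apply: simple_map_preimage.
apply/seteqP; split => x /=; first by move=> h; exists (s x).
by move=> [u _ /= [->]].
Qed.

Lemma strongly_measurable_fun (R : realType) (f : T -> R) :
  strongly_measurable f -> measurable_fun setT f.
Proof.
move=> [s ss sf]; apply: (measurable_fun_cvg (h := s)).
- by move=> n _ A _; rewrite setTI; exact: simple_map_preimage.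
- by move=> x _; exact: sf.
Qed.

End strongly_measurable.

(* [v] is the Riesz representative of the Frechet differential of [f] at [x]. *)
Definition is_gradient (R : realType) (H : preHilbertType R)
    (f : H -> R) (x v : H) :=
  differentiable f x /\ forall h, 'd f x h = inner v h.


Section square_integrable.
Context d (T : measurableType d) (R : realType).
Context (P : {measure set T -> \bar R}) (H : preHilbertType R).

Definition square_integrable (f : T -> H) :=
  strongly_measurable f /\ P.-integrable setT (EFin \o (fun x => `|f x| ^+ 2)).

Lemma strongly_measurable_inner (f g : T -> H) :
  strongly_measurable f -> strongly_measurable g ->
  measurable_fun setT (fun x => inner (f x) (g x)).
Proof.
move=> [s ss sf] [t st tg]; apply: strongly_measurable_fun.
exists (fun n x => inner (s n x) (t n x)).
  by move=> n; exact: (simple_map_comp2 (@inner R H)).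
by move=> x; exact: cvg_inner.
Qed.

Lemma strongly_measurableD (f g : T -> H) :
  strongly_measurable f -> strongly_measurable g ->
  strongly_measurable (fun x => f x + g x).
Proof.
move=> [s ss sf] [t st tg]; exists (fun n x => s n x + t n x).
  by move=> n; exact: (simple_map_comp2 +%R).
by move=> x; exact: cvgD.
Qed.

Lemma strongly_measurableZ (a : R) (f : T -> H) :
  strongly_measurable f -> strongly_measurable (fun x => a *: f x).
Proof.
move=> [s ss sf]; exists (fun n x => a *: s n x).
  by move=> n; exact: (simple_map_comp2 (fun y _ => a *: y) (ss n) (ss n)).
by move=> x; exact: cvgZr.
Qed.

Lemma integrable_inner (f g : T -> H) :
  square_integrable f -> square_integrable g ->
  P.-integrable setT (EFin \o (fun x => inner (f x) (g x))).
Proof.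
move=> [mf intf] [mg intg].
apply: le_integrable (integrableD measurableT intf intg) => //.
  by apply/measurable_EFinP; exact: strongly_measurable_inner.
by move=> x _ /=; rewrite lee_fin (le_trans (inner_le_norm _ _))// ler_norm.
Qed.

Lemma square_integrableD (f g : T -> H) :
  square_integrable f -> square_integrable g ->
  square_integrable (fun x => f x + g x).
Proof.
move=> [mf intf] [mg intg]; have mfg := strongly_measurableD mf mg; split=> //.
apply: le_integrable
  (integrableZl measurableT 2 (integrableD measurableT intf intg)) => //.
  apply/measurable_EFinP; under eq_fun do rewrite -inner_sqr_norm.
  exact: strongly_measurable_inner.
move=> x _ /=; rewrite lee_fin ger0_norm ?sqr_ge0//.
by rewrite (le_trans (sqr_normD _ _))// ler_norm.
Qed.

Lemma square_integrableZ (a : R) (f : T -> H) :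
  square_integrable f -> square_integrable (fun x => a *: f x).
Proof.
move=> [mf intf]; split; first exact: strongly_measurableZ.
rewrite [X in _.-integrable _ X](_ : _ = (fun x => (a ^+ 2)%:E * (`|f x| ^+ 2)%:E)%E).
  exact: integrableZl.
by apply/funext => x /=; rewrite normrZ exprMn real_normK ?num_real.
Qed.

Lemma square_integrable0 : square_integrable (fun=> 0).
Proof.
split.
  exists (fun _ _ => 0) => [_|x]; last exact: cvg_cst.
  split => [|y].
    by apply: (@sub_finite_set _ _ [set 0]) => // _ [x _ <-].
  have [->|y0] := pselect (y = 0).
    by rewrite (_ : _ @^-1` _ = setT)//; apply/seteqP; split.
  rewrite (_ : _ @^-1` _ = set0)//.
  by apply/seteqP; split => // x /= /esym.
rewrite [X in _.-integrable _ X](_ : _ = cst 0%E); first exact: integrable0.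
by apply/funext => x /=; rewrite normr0 expr0n.
Qed.

Record L2map := MkL2map {
  l2map_fun :> T -> H ; l2map_square_integrable : square_integrable l2map_fun }.

HB.instance Definition _ := gen_eqMixin L2map.
HB.instance Definition _ := gen_choiceMixin L2map.

Definition ae_equal (f g : L2map) := `[< f = g %[ae P] >].

Let ae_equal_refl : reflexive ae_equal.
Proof. by move=> f; exact/asboolP/ae_eq_refl. Qed.

Let ae_equal_sym : symmetric ae_equal.
Proof. by move=> f g; apply/asboolP/asboolP; exact: ae_eq_sym. Qed.

Let ae_equal_trans : transitive ae_equal.
Proof.
by move=> f g h /asboolP gf /asboolP fh; apply/asboolP/(ae_eq_trans gf fh).
Qed.

Canonical ae_equal_equiv :=
  EquivRel ae_equal ae_equal_refl ae_equal_sym ae_equal_trans.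

End square_integrable.

Section L2.
Context d (T : measurableType d) (R : realType).
Context (P : {measure set T -> \bar R}) (H : preHilbertType R).
Local Open Scope quotient_scope.

(* L^2(T, H, P): square-integrable maps modulo equality P-almost everywhere, with
   inner product <f, g> = \int <f x, g x> dP(x). As a function, an element of
   [L2] is a chosen representative of its class. *)
Definition L2 : Type := {eq_quot @ae_equal _ _ _ P H}.
HB.instance Definition _ := Choice.on L2.
HB.instance Definition _ := EqQuotient.on L2.

Definition L2_fun (f : L2) : T -> H := repr f.
Coercion L2_fun : L2 >-> Funclass.

Definition L2_class (f : T -> H) (hf : square_integrable P f) : L2 :=
  \pi_L2 (MkL2map hf).

Lemma L2_fun_square_integrable (f : L2) : square_integrable P f.
Proof. exact: l2map_square_integrable. Qed.
Local Notation sqint := L2_fun_square_integrable.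

Lemma L2_classE (f : T -> H) (hf : square_integrable P f) :
  \forall x \ae P, L2_class hf x = f x.
Proof.
have /eqmodP/asboolP : L2_class hf = \pi_L2 (repr (L2_class hf)) by rewrite reprK.
move=> /ae_eq_sym; apply: filterS => x; exact.
Qed.

Lemma L2P (f g : L2) : (\forall x \ae P, f x = g x) -> f = g.
Proof.
move=> fg; rewrite -[f]reprK -[g]reprK; apply/eqmodP/asboolP.
by apply: filterS fg => x.
Qed.

Definition L2_zero : L2 := L2_class (square_integrable0 P H).
Definition L2_add (f g : L2) : L2 :=
  L2_class (square_integrableD (sqint f) (sqint g)).
Definition L2_scale (a : R) (f : L2) : L2 :=
  L2_class (square_integrableZ a (sqint f)).
Definition L2_opp (f : L2) : L2 := L2_scale (-1) f.

Let zeroE : \forall x \ae P, L2_zero x = 0. Proof. exact: L2_classE. Qed.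
Let addE f g : \forall x \ae P, L2_add f g x = f x + g x.
Proof. exact: L2_classE. Qed.
Let scaleE a f : \forall x \ae P, L2_scale a f x = a *: f x.
Proof. exact: L2_classE. Qed.

Let addA : associative L2_add.
Proof.
move=> f g h; apply: L2P.
apply: filterS3 (addE f (L2_add g h)) (addE g h)
  (filterI (addE (L2_add f g) h) (addE f g)).
by move=> x -> -> [-> ->]; rewrite addrA.
Qed.

Let addC : commutative L2_add.
Proof.
move=> f g; apply: L2P; apply: filterS2 (addE f g) (addE g f).
by move=> x -> ->; rewrite addrC.
Qed.

Let add0 : left_id L2_zero L2_add.
Proof.
move=> f; apply: L2P; apply: filterS2 (addE L2_zero f) zeroE.
by move=> x -> ->; rewrite add0r.
Qed.

Let addN : left_inverse L2_zero L2_opp L2_add.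
Proof.
move=> f; apply: L2P.
apply: filterS3 (addE (L2_opp f) f) (scaleE (-1) f) zeroE.
by move=> x -> -> ->; rewrite scaleN1r addNr.
Qed.

HB.instance Definition _ := GRing.isZmodule.Build L2 addA addC add0 addN.

Let scaleA a b f : L2_scale a (L2_scale b f) = L2_scale (a * b) f.
Proof.
apply: L2P.
apply: filterS3 (scaleE a (L2_scale b f)) (scaleE b f) (scaleE (a * b) f).
by move=> x -> -> ->; rewrite scalerA.
Qed.

Let scale1 : left_id 1 L2_scale.
Proof.
by move=> f; apply: L2P; apply: filterS (scaleE 1 f) => x ->; rewrite scale1r.
Qed.

Let scaleDr : right_distributive L2_scale +%R.
Proof.
move=> a f g; apply: L2P.
apply: filterS3 (scaleE a (f + g)) (addE f g)
  (filterI (addE (L2_scale a f) (L2_scale a g))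
    (filterI (scaleE a f) (scaleE a g))).
by move=> x -> -> [-> [-> ->]]; rewrite scalerDr.
Qed.

Let scaleDl f : {morph L2_scale^~ f : a b / a + b}.
Proof.
move=> a b; apply: L2P.
apply: filterS3 (scaleE (a + b) f) (addE (L2_scale a f) (L2_scale b f))
  (filterI (scaleE a f) (scaleE b f)).
by move=> x -> -> [-> ->]; rewrite scalerDl.
Qed.

HB.instance Definition _ :=
  GRing.Zmodule_isLmodule.Build R L2 scaleA scale1 scaleDr scaleDl.

Lemma L2_0E : \forall x \ae P, (0 : L2) x = 0. Proof. exact: zeroE. Qed.

Lemma L2_addE (f g : L2) : \forall x \ae P, (f + g : L2) x = f x + g x.
Proof. exact: addE. Qed.

Lemma L2_scaleE a (f : L2) : \forall x \ae P, (a *: f : L2) x = a *: f x.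
Proof. exact: scaleE. Qed.

Definition L2_inner (f g : L2) : R := \int[P]_x (inner (f x) (g x)).

Let intg (f g : L2) :
  P.-integrable setT (EFin \o (fun x => inner (f x) (g x))).
Proof. by apply: integrable_inner; exact: sqint. Qed.

Let ae_Rintegral (u v : T -> R) : P.-integrable setT (EFin \o u) ->
  P.-integrable setT (EFin \o v) -> (\forall x \ae P, u x = v x) ->
  \int[P]_x (u x) = \int[P]_x (v x).
Proof.
move=> iu iv uv; congr fine; apply: ae_eq_integral => //.
- exact: measurable_int iu.
- exact: measurable_int iv.
- by apply: filterS uv => x /= -> _.
Qed.

Let innerC (f g : L2) : L2_inner f g = L2_inner g f.
Proof. by apply: eq_Rintegral => x _; rewrite innerC. Qed.

Let inner_linear (g : L2) a (f h : L2) :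
  L2_inner (a *: f + h) g = a * L2_inner f g + L2_inner h g.
Proof.
rewrite /L2_inner.
have iag : P.-integrable setT (EFin \o (fun x => a * inner (f x) (g x))).
  exact: (integrableZl measurableT a (intg f g)).
rewrite -RintegralZl// -RintegralD//.
apply: ae_Rintegral; first exact: intg.
  exact: (integrableD measurableT iag (intg h g)).
apply: filterS2 (L2_addE (a *: f) h) (L2_scaleE a f).
by move=> x -> ->; rewrite innerDl innerZl.
Qed.

Let inner_bilinear : bilinear_for *%R (idfun \; *%R) L2_inner.
Proof.
split=> [g|f] a h k; first exact: inner_linear.
by rewrite !(innerC f) inner_linear.
Qed.

HB.instance Definition _ :=
  @bilinear_isBilinear.Build R L2 L2 R *%R (idfun \; *%R) L2_inner inner_bilinear.

Let inner_hermitian f g : L2_inner f g = (-1) ^+ false * idfun (L2_inner g f).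
Proof. by rewrite expr0 mul1r innerC. Qed.

HB.instance Definition _ :=
  @isHermitianSesquilinear.Build R L2 false idfun L2_inner inner_hermitian.

Let inner_gt0 (f : L2) : f != 0 -> 0 < L2_inner f f.
Proof.
move=> f0; rewrite lt_neqAle; apply/andP; split; last first.
  by apply: Rintegral_ge0 => x _; rewrite inner_sqr_norm sqr_ge0.
apply: contra f0 => /eqP/esym ff0; apply/eqP/L2P.
have : (\int[P]_x `|(inner (f x) (f x))%:E| = 0)%E.
  have ff_ge0 x : (0 <= (inner (f x) (f x))%:E)%E.
    by rewrite lee_fin inner_sqr_norm sqr_ge0.
  under eq_integral do rewrite gee0_abs//.
  rewrite -[LHS]fineK; last exact: (integrable_fin_num measurableT (intg f f)).
  by congr EFin.
move=> /(ae_eq_integral_abs P measurableT (measurable_int P (intg f f))).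
apply: filterS2 L2_0E => x -> /(_ Logic.I) /= /eqP.
by rewrite eqe inner_sqr_norm sqrf_eq0 normr_eq0 => /eqP.
Qed.

HB.instance Definition _ := @isDotProduct.Build R L2 L2_inner inner_gt0.

HB.instance Definition _ := @Lmodule_isNormed.Build R L2 (dot_norm L2_inner)
  (@dot_normD _ _ L2_inner) (@dot_normZ _ _ L2_inner) (@dot_norm_eq0 _ _ L2_inner).

Let inner_sqr_norm (f : L2) : L2_inner f f = `|f| ^+ 2.
Proof. by rewrite sqr_sqrtr// dot_ge0. Qed.

HB.instance Definition _ := NormedModule_hasInner.Build R L2 innerC
  (dotDl L2_inner) (dotZl L2_inner) inner_sqr_norm.

End L2.

Definition borel (R : realType) (Z : hilbertType R) :
    measurableType (@open Z).-sigma :=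
  g_sigma_algebraType (@open Z).

Section equivariance.
Context (R : realType) (Z : hilbertType R) (G : groupType).
Variable act : G -> Z -> Z.

Definition is_action :=
  (forall z, act 1%g z = z) /\
  forall g h z, act (g * h)%g z = act g (act h z).

Definition acts_linearly :=
  (forall g z z', act g (z + z') = act g z + act g z') /\
  forall g (a : R) z, act g (a *: z) = a *: act g z.

Definition acts_with_adjoint :=
  forall g z z', inner (act g z) z' = inner z (act g^-1%g z').

(* (g . Omega)(z) = g . Omega(g^-1 . z) *)
Definition conj_act (g : G) (Omega : Z -> Z) (z : Z) : Z :=
  act g (Omega (act g^-1%g z)).

Variable p : probability (borel Z) R.

(* z and g . z have the same law when z ~ p. *)
Definition law_stable :=
  forall g (A : set (borel Z)), measurable A ->
    pushforward p (act g : borel Z -> borel Z) A = p A.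

(* g . Omega = Omega in L^2, i.e. p-almost everywhere. [equivariantP] and
   [equivariant_L2_class] relate this to Omega (g . z) = g . Omega z. *)
Definition equivariant (Omega : L2 p Z) :=
  forall g, \forall z \ae p, conj_act g Omega z = Omega z.

Hypotheses (act1M : is_action) (act_lin : acts_linearly).
Hypotheses (act_adj : acts_with_adjoint) (p_stable : law_stable).

Let actV g z : act g (act g^-1%g z) = z.
Proof. by rewrite -act1M.2 mulgV act1M.1. Qed.

Let actVK g z : act g^-1%g (act g z) = z.
Proof. by rewrite -act1M.2 mulVg act1M.1. Qed.

Lemma act_isometry g z : `|act g z| = `|z|.
Proof.
by apply/eqP; rewrite -(@eqrXn2 _ 2)// -!inner_sqr_norm act_adj actVK.
Qed.

Lemma act_continuous g : continuous (act g).
Proof.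
move=> z; apply/cvgrPdist_lt => e e0; near=> y.
rewrite -scaleN1r -act_lin.2 -act_lin.1 act_isometry scaleN1r.
by near: y; exact: cvgr_dist_lt.
Unshelve. all: by end_near. Qed.

Lemma act_measurable g :
  measurable_fun [set: borel Z] (act g : borel Z -> borel Z).
Proof.
apply: (@measurability _ _ (borel Z) (borel Z) setT (act g) (@open Z)) => //.
move=> _ [A oA <-]; rewrite setTI; apply: sub_sigma_algebra.
by move: A oA; apply/continuousP; exact: act_continuous.
Qed.

Lemma borel_ae_filter : Filter (almost_everywhere p).
Proof. by apply: ae_filter_ringOfSetsType. Qed.
#[local] Existing Instance borel_ae_filter.

Lemma ae_act g (Q : borel Z -> Prop) :
  (\forall z \ae p, Q z) -> \forall z \ae p, Q (act g z).
Proof.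
move=> [N [mN pN NQ]]; exists (act g @^-1` N); split.
- by rewrite -[X in measurable X]setTI; exact: act_measurable.
- by rewrite -[LHS](p_stable g mN) in pN *.
- by move=> z /= nQ; exact: NQ.
Qed.

Lemma equivariantP (Omega : L2 p Z) : equivariant Omega <->
  forall g, \forall z \ae p, Omega (act g z) = act g (Omega z).
Proof.
split=> h g.
  have := ae_act g (h g).
  by apply: filterS => z; rewrite /conj_act actVK => ->.
have := ae_act g^-1%g (h g).
by apply: filterS => z; rewrite /conj_act actV => <-.
Qed.

Lemma equivariant_L2_class (f : borel Z -> Z) (hf : square_integrable p f) :
  (forall g z, f (act g z) = act g (f z)) -> equivariant (L2_class hf).
Proof.
move=> fact; apply/equivariantP => g.
apply: filterS2 (L2_classE hf) (ae_act g (L2_classE hf)).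
by move=> z -> ->; exact: fact.
Qed.

End equivariance.

#[global] Existing Instance borel_ae_filter.

(* E_{z ~ p}[L (Omega z)]; meaningful when L \o Omega is p-integrable. If L is Borel
   measurable, this does not depend on the representative of Omega. *)
Definition expected_loss (R : realType) (Z : hilbertType R)
    (p : probability (borel Z) R) (L : Z -> R) (Omega : L2 p Z) : R :=
  fine 'E_p[L \o Omega].

(* Main.v *)
Require Import Defs.
From HB Require Import structures.
From mathcomp Require Import all_boot all_order all_algebra.
From mathcomp Require Import all_classical all_reals all_analysis.
From mathcomp Require Import measurable_realfun.
Set Implicit Arguments.
Unset Strict Implicit.
Unset Printing Implicit Defensive.

Import Order.TTheory GRing.Theory Num.Theory numFieldNormedType.Exports.

Local Open Scope classical_set_scope.
Local Open Scope ring_scope.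

(** The idea is that the loss functional is invariant under the conjugation
    action of [G] on [L2 p Z], and that the gradient of an invariant functional
    at a fixed point is again a fixed point.

    Conjugation by [g] is a linear isometry [T] of [L2 p Z]: the inner product
    of [Z] is [G]-invariant, and so is integration against [p]
    ([integral_act], [norm_L2_conj]). Near [Omega0] the functional satisfies
    [f (T Omega) = f Omega], because [L] is [G]-invariant and the change of
    variables [z |-> g^-1 . z] preserves [p] ([expected_loss_conj]). If moreover
    [T Omega0 = Omega0], the directional derivatives of [f] at [Omega0] along
    [h] and along [T h] coincide, so the gradient [v] satisfies
    [<v, h> = <v, T h>] for all [h]. For [h = v], together with [|T v| = |v|],
    this gives [|T v - v|^2 = 2 |v|^2 - 2 <v, T v> = 0]
    ([gradient_fixed]). So [T] fixes both [Omega0] and the gradient, and by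
    linearity it fixes [Omega0 - eta *: grad]. *)

Lemma isometry_fixed_cvg (R : realType) (V : normedModType R) (T : V -> V)
    (x : V) :
  linear T -> (forall y, `|T y| = `|y|) -> T x = x -> T @ x --> x.
Proof.
move=> Tlin Tnorm Tx; apply/cvgrPdist_lt => e e0; near=> y.
have -> : x - T y = T (x - y).
  by rewrite -(scaleN1r y) (addrC x (_ *: _)) Tlin Tx scaleN1r addrC.
by rewrite Tnorm; near: y; exact: cvgr_dist_lt.
Unshelve. all: by end_near. Qed.

(** A gradient of [f] at [x] inherits the symmetries of [f] near [x] that fix
    [x]. *)
Lemma gradient_fixed (R : realType) (H : preHilbertType R) (f : H -> R)
    (T : H -> H) (x v : H) :
  linear T -> (forall y, `|T y| = `|y|) -> T x = x ->
  (\forall y \near x, f (T y) = f y) -> is_gradient f x v -> T v = v.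
Proof.
move=> Tlin Tnorm Tx fT [df fv].
have dT : 'd f x v = 'd f x (T v).
  rewrite -!deriveE// -(near_eq_derive v fT) /derive /=.
  by under eq_fun do rewrite Tlin Tx.
(* expand [|T v - v|^2], where [<v, T v> = <v, v>] by [dT] *)
apply/eqP; rewrite -subr_eq0 -normr_eq0 -sqrf_eq0.
rewrite -inner_sqr_norm -scaleN1r !(innerDl, innerDr, innerZl, innerZr).
rewrite (innerC (T v) v) -!fv -dT fv !inner_sqr_norm Tnorm.
by apply/eqP; rewrite !mulN1r opprK addrN add0r addNr.
Qed.

Section conjugation.
Context (R : realType) (Z : hilbertType R) (G : groupType).
Context (act : G -> Z -> Z) (p : probability (borel Z) R).
Hypotheses (act1M : is_action act) (act_lin : acts_linearly act).
Hypotheses (act_adj : acts_with_adjoint act) (p_stable : law_stable act p).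

Let mact g : measurable_fun [set: borel Z] (act g : borel Z -> borel Z).
Proof. exact: act_measurable. Qed.

Lemma ge0_integral_act (g : G) (f : borel Z -> \bar R) :
  measurable_fun setT f -> (forall z, 0 <= f z)%E ->
  (\int[p]_(z in [set: borel Z]) f (act g z : borel Z) = \int[p]_z f z)%E.
Proof.
move=> mf f0.
apply: etrans (esym (ge0_integral_pushforward (mact g) p measurableT mf _)) _.
  by move=> z _; exact: f0.
by apply: eq_measure_integral => A mA _; exact: p_stable.
Qed.

Lemma integral_act (g : G) (f : borel Z -> \bar R) :
  measurable_fun setT f ->
  (\int[p]_(z in [set: borel Z]) f (act g z : borel Z) = \int[p]_z f z)%E.
Proof.
move=> mf; rewrite integralE [RHS]integralE; congr (_ - _)%E.
- rewrite -(ge0_integral_act g (measurable_funepos mf))//.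
  by apply: eq_integral => z _; rewrite !funeposE.
- rewrite -(ge0_integral_act g (measurable_funeneg mf))//.
  by apply: eq_integral => z _; rewrite !funenegE.
Qed.

Lemma strongly_measurable_conj_act g (f : borel Z -> Z) :
  strongly_measurable f ->
  strongly_measurable (conj_act act g f : borel Z -> Z).
Proof.
move=> [s ss sf]; exists (fun n => conj_act act g (s n)) => [n|z].
  have [fs _] := ss n; split.
    apply: (@sub_finite_set _ _ (act g @` range (s n))); last exact: finite_image.
    by move=> _ [z _ <-]; exists (s n (act g^-1%g z)) => //; exists (act g^-1%g z).
  move=> y; rewrite -[X in measurable X]setTI.
  (* the fibre over [y] is the preimage of [act g @^-1` [set y]] by
     [s n \o act g^-1] *)
  exact: (@mact g^-1%g measurableT _ (simple_map_preimage (act g @^-1` [set y]) (ss n))).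
have act_cont : {for f (act g^-1%g z), continuous (act g)}.
  exact: act_continuous.
exact: (continuous_cvg _ act_cont (sf _)).
Qed.

Lemma square_integrable_conj_act g (f : borel Z -> Z) :
  square_integrable p f ->
  square_integrable p (conj_act act g f : borel Z -> Z).
Proof.
move=> [mf /integrableP[mf2 intf]]; split; first exact: strongly_measurable_conj_act.
rewrite (_ : _ \o _ = (EFin \o (fun x => `|f x| ^+ 2)) \o act g^-1%g); last first.
  by apply/funext => z /=; rewrite /conj_act (act_isometry act1M).
apply/integrableP; split; first exact: measurableT_comp mf2 (mact _).
rewrite (@integral_act g^-1%g (fun z => `|(`|f z| ^+ 2)%:E|)%E)//.
exact: measurableT_comp mf2.
Qed.

(** The conjugation action of [G] on classes of square-integrable maps. *)
Definition L2_conj g (Omega : L2 p Z) : L2 p Z :=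
  L2_class (square_integrable_conj_act g (L2_fun_square_integrable Omega)).

Lemma L2_conjE g (Omega : L2 p Z) :
  \forall z \ae p, L2_conj g Omega z = conj_act act g Omega z.
Proof. exact: L2_classE. Qed.

Lemma equivariant_L2_conj (Omega : L2 p Z) :
  equivariant act Omega <-> forall g, L2_conj g Omega = Omega.
Proof.
split=> h g; first by apply: L2P; apply: filterS2 (L2_conjE g Omega) (h g) => z ->.
by have := L2_conjE g Omega; rewrite (h g); apply: filterS => z.
Qed.

Lemma L2_conj_linear g : linear (L2_conj g).
Proof.
suff conjD a (u v : L2 p Z) :
    L2_conj g (a *: u + v) = a *: L2_conj g u + L2_conj g v by [].
apply: L2P.
have auv : \forall z \ae p, (a *: u + v : L2 p Z) z = a *: u z + v z.
  by apply: filterS2 (L2_addE (a *: u) v) (L2_scaleE a u) => z -> ->.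
have := ae_act act1M act_lin act_adj p_stable g^-1%g auv.
move/(filterI (L2_conjE g v)).
apply: filterS3 (filterI (L2_conjE g (a *: u + v)) (L2_conjE g u))
  (filterI (L2_addE (a *: L2_conj g u) (L2_conj g v))
    (L2_scaleE a (L2_conj g u))).
move=> z [-> Eu] [-> ->] [Ev Euv].
by rewrite Eu Ev /conj_act Euv act_lin.1 act_lin.2.
Qed.

Lemma norm_L2_conj g (Omega : L2 p Z) : `|L2_conj g Omega| = `|Omega|.
Proof.
have mO (Xi : L2 p Z) :
    measurable_fun setT (EFin \o (fun z => inner (Xi z) (Xi z))).
  exact: (measurable_int p (integrable_inner (L2_fun_square_integrable Xi)
    (L2_fun_square_integrable Xi))).
apply/eqP; rewrite -(@eqrXn2 _ 2)// -!inner_sqr_norm; apply/eqP.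
rewrite -[LHS]/(L2_inner _ _) -[RHS]/(L2_inner _ _) /L2_inner /Rintegral.
congr fine; rewrite -(@integral_act g^-1%g _ (mO Omega)).
apply: ae_eq_integral => //.
- exact: mO.
- exact: measurableT_comp (mO Omega) (mact _).
apply: filterS (L2_conjE g Omega) => z /= -> _.
by rewrite !inner_sqr_norm /conj_act (act_isometry act1M).
Qed.

(** [L] need not be measurable, so a.e. equal maps [Omega] and [Xi] could a priori
    give compositions [L \o Omega] and [L \o Xi] with different integrals; the
    integrability of both compositions with the chosen representatives provides
    the measurability that the change of variables uses. *)
Lemma expected_loss_conj (L : Z -> R) g (Omega : L2 p Z) :
  (forall g z, L (act g z) = L z) ->
  p.-integrable setT (EFin \o (L \o Omega)) ->
  p.-integrable setT (EFin \o (L \o L2_conj g Omega)) ->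
  expected_loss L (L2_conj g Omega) = expected_loss L Omega.
Proof.
move=> Linv /measurable_int mO /measurable_int mgO.
rewrite /expected_loss unlock; congr fine.
rewrite -(@integral_act g^-1%g (EFin \o (L \o Omega)))//.
apply: ae_eq_integral => //.
  exact: measurableT_comp mO (mact _).
by apply: filterS (L2_conjE g Omega) => z /= -> _; rewrite /conj_act Linv.
Qed.

End conjugation.

Theorem proposition3 (R : realType) (Z : hilbertType R) (G : groupType)
    (act : G -> Z -> Z) (L : Z -> R) (p : probability (borel Z) R)
    (eta : R) (Omega0 grad : L2 p Z) :
  is_action act ->
  acts_linearly act ->
  acts_with_adjoint act ->
  (forall g z, L (act g z) = L z) ->
  law_stable act p ->
  equivariant act Omega0 ->
  (\forall Omega \near Omega0,
    p.-integrable setT (EFin \o (L \o (Omega : L2 p Z)))) ->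
  is_gradient (expected_loss L) Omega0 grad ->
  equivariant act (Omega0 - eta *: grad).
Proof.
move=> act1M act_lin act_adj Linv p_stable.
move=> /(equivariant_L2_conj act1M act_lin act_adj p_stable) fix0 intL gradL.
apply/(equivariant_L2_conj act1M act_lin act_adj p_stable) => g.
set T := L2_conj act1M act_lin act_adj p_stable g.
have Tlin : linear T by exact: L2_conj_linear.
have Tnorm Omega : `|T Omega| = `|Omega| by exact: norm_L2_conj.
have T0 : T Omega0 = Omega0 by exact: fix0.
have T_cont : T @ Omega0 --> Omega0 by exact: isometry_fixed_cvg.
have Tgrad : T grad = grad.
  apply: gradient_fixed Tlin Tnorm T0 _ gradL.
  apply: filterS2 intL (T_cont _ intL) => Omega iO iTO.
  exact: expected_loss_conj.
by rewrite addrC -scaleNr Tlin Tgrad T0.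
Qed.
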